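(* Let $\eta, L\in\mathbb{C}$. If $$(\sqrt{2}-1)\,|2L-1|+2|\eta|<\frac{\sqrt{2}}{4},$$ then the normalized regular Coulomb wave function $z\mapsto g_{L,\eta}(z)$ is lemniscate starlike in the unit disk $\mathbb{D}=\{z\in\mathbb{C}:|z|<1\}$.
   Context: Regular Coulomb wave function. For $L,\eta\in\mathbb{C}$, the regular Coulomb wave function is $$F_{L,\eta}(z)=z^{L+1}e^{-iz}C_{L}(\eta)\,{}_{1}F_{1}\left(L+1-i\eta,2L+2;2iz\right)=C_{L}(\eta)\sum_{n\geq0}a_{L,n}z^{n+L+1},$$ where ${}_1F_1$ is the Kummer confluent hypergeometric function, $$C_{L}(\eta)=\frac{2^{L}e^{-\frac{\pi\eta}{2}}\left|\Gamma(L+1+i\eta)\right|}{\Gamma(2L+2)},$$ and $a_{L,0}=1$, $a_{L,1}=\frac{\eta}{L+1}$, $a_{L,n}=\frac{2\eta a_{L,n-1}-a_{L,n-2}}{n(n+2L+1)}$ for $n\geq 2$. Normalized form. $g_{L,\eta}(z)=C_{L}^{-1}(\eta)z^{-L}F_{L,\eta}(z)$, that is, $g_{L,\eta}(z)=\sum_{n\ge 0}a_{L,n}z^{n+1}=z e^{-iz}\,{}_1F_1(L+1-i\eta,2L+2;2iz)$. Function classes. $\mathcal{A}$ is the class of analytic functions $f$ on $\mathbb{D}$ with $f(0)=0$, $f'(0)=1$; $\mathcal{S}\subset\mathcal{A}$ is the subclass of univalent functions. For $f,g$ analytic in $\mathbb{D}$, $f\prec g$ ($f$ is subordinate to $g$)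 means that there is an analytic $w$ on $\mathbb{D}$ with $w(0)=0$, $|w(z)|<1$ and $f(z)=g(w(z))$ for all $z\in\mathbb{D}$. A function $f$ is lemniscate starlike in $\mathbb{D}$ if it belongs to the class $\mathcal{SL}=\mathcal{S}^{\star}(\sqrt{1+z})=\{f\in\mathcal{S}: zf'(z)/f(z)\prec\sqrt{1+z}\}$, where the principal branch of the square root is used and $zf'(z)/f(z)$ is understood to take the value $1$ at $z=0$. *)

(* Defs.v *)
From Stdlib Require Import Reals Factorial.
From Coquelicot Require Import Coquelicot.

Local Open Scope C_scope.

(* The sum of a complex series, taken componentwise: convergence in [C] is
   convergence of real and imaginary parts, and [Series] is total. *)
Definition CSeries (a : nat -> C) : C :=
  (Series (fun n => Re (a n)), Series (fun n => Im (a n))).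

Definition Cexp (z : C) : C :=
  (exp (Re z) * cos (Im z), exp (Re z) * sin (Im z))%R.

(* Principal branch, with image in [{Re > 0}] together with [{iy | y >= 0}]:
   on the cut (negative reals) the value is the one with positive imaginary
   part. *)
Definition Csqrt (z : C) : C :=
  (sqrt ((Cmod z + Re z) / 2),
   (if Rlt_dec (Im z) 0 then -1 else 1) * sqrt ((Cmod z - Re z) / 2))%R.

(* Rising factorial [a (a+1) ... (a+n-1)]. *)
Fixpoint pochhammer (a : C) (n : nat) : C :=
  match n with
  | O => 1
  | S m => pochhammer a m * (a + INR m)
  end.

(* [1F1(a, b; z)]; meaningful when [b] is not a nonpositive integer. *)
Definition kummer (a b z : C) : C :=
  CSeries (fun n =>
    pochhammer a n / (pochhammer b n * INR (fact n)) * z ^ n).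

(* [g_{L,eta}(z) = C_L(eta)^-1 z^-L F_{L,eta}(z)], where
   [F_{L,eta}(z) = z^(L+1) e^(-iz) C_L(eta) 1F1(L+1-i eta, 2L+2; 2iz)] is the
   regular Coulomb wave function. The constant [C_L(eta)] and the multivalued
   power [z^L] cancel, which also gives the value at [0]. *)
Definition coulomb_g (L eta z : C) : C :=
  z * Cexp (- (Ci * z)) * kummer (L + 1 - Ci * eta) (2 * L + 2) (2 * Ci * z).

Definition unit_disk (z : C) : Prop := (Cmod z < 1)%R.

Definition analytic_on_disk (f : C -> C) : Prop :=
  forall z : C, unit_disk z -> ex_derive f z.

Definition class_A (f : C -> C) : Prop :=
  analytic_on_disk f /\ f 0 = 0 /\ C_derive f 0 = 1.

Definition univalent_on_disk (f : C -> C) : Prop :=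
  forall z1 z2 : C, unit_disk z1 -> unit_disk z2 -> f z1 = f z2 -> z1 = z2.

Definition class_S (f : C -> C) : Prop :=
  class_A f /\ univalent_on_disk f.

Definition subordinate (f g : C -> C) : Prop :=
  exists w : C -> C,
    analytic_on_disk w /\
    w 0 = 0 /\
    (forall z : C, unit_disk z -> (Cmod (w z) < 1)%R) /\
    (forall z : C, unit_disk z -> f z = g (w z)).

(* [z f'(z) / f(z)], with its value [1] at [0] filled in. *)
Definition log_derivative_ratio (f : C -> C) (z : C) : C :=
  if Ceq_dec z 0 then 1 else z * C_derive f z / f z.

Definition lemniscate_starlike (f : C -> C) : Prop :=
  class_S f /\
  subordinate (log_derivative_ratio f) (fun z => Csqrt (1 + z)).

(* Main.v *)
Require Import Defs.
From Stdlib Require Import Reals Lra Lia Factorial FunctionalExtensionality.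
From Coquelicot Require Import Coquelicot.

(** Write [g (z) = z a (z)] with [a (z) = sum a_n z^n], [d = |2 L - 1|], [e = 2 |eta|] and
    [k = sqrt 2 - 1]; the hypothesis is [k d + e < sqrt 2 / 4], and in particular [d < 1].
    Everything is reduced to estimates of Taylor coefficients.

    Lemniscate condition. Let [q = z g' / g - 1]. Since [k (2 + k) = 1], the bound
    [|q| < k] on the disk implies [|(1 + q)^2 - 1| < 1], so [w = 2 q + q^2] is a Schwarz
    function, and [1 + q], which has positive real part, is the principal root of
    [1 + w]. To bound [q], write [q = z r]. The Coulomb equation becomes the Riccati
    equation [theta r + (2 L + 2) r + z r^2 = 2 eta - z], with [theta = z d/dz], that is,
    [(n + 2 L + 2) r_n] is the coefficient of [z^n] in [2 eta - z - z r^2]. As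
    [|n + 2 L + 2| >= n + 3 - d], the partial sums of [sum |r_n|] stay below
    [e / (3 - d) + (1 + k^2) / (4 - d)] as long as they stay below [k]; and this number
    is smaller than [k] ([riccati_fixpoint_lt], [sum_Cmod_riccati_le]).

    The series [r] is defined by the Riccati recursion rather than as a quotient, so its
    coefficients can be bounded before [a] is known to have no zeros;
    [theta_coulomb_coeff] then shows [theta a = z r a] as formal series, by uniqueness
    for a first-order linear equation.

    Univalence. The recurrence of the [a_n] gives [sum_{n >= 1} (n + 1) |a_n| < 1]
    ([sum_univalence_le]), so in [g (z) - g (w)] the linear term dominates
    ([power_series_shift_injective]). In particular [g] vanishes only at 0, so
    [theta a = z r a] may be divided by [a].

    Link with the definition. [kummer_coeff] shows coefficientwise that
    [1F1 (L + 1 - i eta, 2 L + 2; 2 i z) = e^(i z) a (z)]; multiplication by [z e^(-i z)]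
    gives [g]. *)

Local Open Scope C_scope.

(** * Formal power series as coefficient sequences *)

(** The Cauchy product, by recursion on the index, so that its algebra follows by
    induction without reindexing finite sums. *)
Fixpoint conv (f g : nat -> C) (n : nat) : C :=
  match n with
  | O => f 0%nat * g 0%nat
  | S m => f 0%nat * g n + conv (fun k => f (S k)) g m
  end.

(** Multiplication by [z]. *)
Definition shift (f : nat -> C) (n : nat) : C :=
  match n with O => 0 | S m => f m end.

(** The Euler derivation [z d/dz]. *)
Definition theta (f : nat -> C) (n : nat) : C := INR n * f n.

Lemma RtoC_INR_S (n : nat) : RtoC (INR (S n)) = INR n + 1.
Proof. rewrite S_INR, RtoC_plus. reflexivity. Qed.

Lemma conv_plus_l (f f' g : nat -> C) (n : nat) :
  conv (fun k => f k + f' k) g n = conv f g n + conv f' g n.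
Proof.
  revert f f'; induction n as [|n IH]; intros f f'; simpl; [ring|].
  rewrite (IH (fun k => f (S k)) (fun k => f' (S k))); ring.
Qed.

Lemma conv_scal_l (c : C) (f g : nat -> C) (n : nat) :
  conv (fun k => c * f k) g n = c * conv f g n.
Proof.
  revert f; induction n as [|n IH]; intros f; simpl; [ring|].
  rewrite (IH (fun k => f (S k))); ring.
Qed.

Lemma conv_plus_r (f g g' : nat -> C) (n : nat) :
  conv f (fun k => g k + g' k) n = conv f g n + conv f g' n.
Proof.
  revert f; induction n as [|n IH]; intros f; simpl; [ring|].
  rewrite (IH (fun k => f (S k))); ring.
Qed.

Lemma conv_scal_r (c : C) (f g : nat -> C) (n : nat) :
  conv f (fun k => c * g k) n = c * conv f g n.
Proof.
  revert f; induction n as [|n IH]; intros f; simpl; [ring|].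
  rewrite (IH (fun k => f (S k))); ring.
Qed.

Lemma conv_assoc (f g h : nat -> C) (n : nat) :
  conv (conv f g) h n = conv f (conv g h) n.
Proof.
  revert f; induction n as [|n IH]; intros f; simpl; [ring|].
  rewrite (conv_plus_l (fun k => f 0%nat * g (S k))), conv_scal_l, IH; ring.
Qed.

Lemma conv_ext_le (f f' g g' : nat -> C) (n : nat) :
  (forall k, (k <= n)%nat -> f k = f' k) ->
  (forall k, (k <= n)%nat -> g k = g' k) -> conv f g n = conv f' g' n.
Proof.
  revert f f'; induction n as [|n IH]; intros f f' Hf Hg; simpl;
    rewrite Hf, Hg by lia.
  - reflexivity.
  - rewrite (IH _ (fun k => f' (S k))); [reflexivity| |]; intros; [apply Hf|apply Hg]; lia.
Qed.

Lemma conv_shift_l (f g : nat -> C) (n : nat) :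
  conv (shift f) g n = shift (conv f g) n.
Proof.
  destruct n as [|n]; simpl; [ring|].
  change (fun k => f k) with f; ring.
Qed.

Lemma conv_shift_r (f g : nat -> C) (n : nat) :
  conv f (shift g) n = shift (conv f g) n.
Proof.
  revert f; induction n as [|n IH]; intros f; simpl; [ring|].
  rewrite IH; destruct n; simpl; ring.
Qed.

Lemma theta_conv (f g : nat -> C) (n : nat) :
  theta (conv f g) n = conv (theta f) g n + conv f (theta g) n.
Proof.
  unfold theta; revert f; induction n as [|n IH]; intros f; [simpl; ring|].
  cbn [conv].
  transitivity (f 0%nat * (INR (S n) * g (S n))
                + (INR n * conv (fun k => f (S k)) g n
                   + conv (fun k => f (S k)) g n)).
  { rewrite RtoC_INR_S; ring. }
  rewrite IH.
  replace (fun k => INR (S k) * f (S k))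
    with (fun k => INR k * f (S k) + f (S k))
    by (apply functional_extensionality; intro k; rewrite RtoC_INR_S; ring).
  rewrite (conv_plus_l (fun k => INR k * f (S k)) (fun k => f (S k))).
  simpl (INR 0). ring.
Qed.

Lemma conv_pow (f g : nat -> C) (z : C) (n : nat) :
  conv (fun k => f k * z ^ k) (fun k => g k * z ^ k) n = conv f g n * z ^ n.
Proof.
  revert f; induction n as [|n IH]; intros f; [simpl; ring|].
  cbn [conv].
  replace (fun k => f (S k) * z ^ (S k))
    with (fun k => z * (f (S k) * z ^ k))
    by (apply functional_extensionality; intro k; rewrite Cpow_S; ring).
  rewrite conv_scal_l, (IH (fun k => f (S k))), !Cpow_S. simpl (z ^ 0). ring.
Qed.

(** * Absolutely summable complex sequences *)

Definition summable (a : nat -> C) : Prop := ex_series (fun n => Cmod (a n)).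

Lemma summable_of_bounded (a : nat -> C) (M : R) :
  (forall N, sum_n (fun n => Cmod (a n)) N <= M)%R -> summable a.
Proof.
  intro H.
  destruct (ex_finite_lim_seq_incr (sum_n (fun n => Cmod (a n))) M) as [l Hl].
  - intro n. rewrite sum_Sn. unfold plus; simpl.
    pose proof (Cmod_ge_0 (a (S n))). lra.
  - exact H.
  - exists l. exact Hl.
Qed.

Lemma Series_le_of_bounded (a : nat -> C) (M : R) :
  (forall N, sum_n (fun n => Cmod (a n)) N <= M)%R ->
  (Series (fun n => Cmod (a n)) <= M)%R.
Proof.
  intro H. destruct (summable_of_bounded a M H) as [l Hl].
  rewrite (is_series_unique _ _ Hl).
  apply (is_lim_seq_le (sum_n (fun n => Cmod (a n))) (fun _ => M) l M H).
  - exact Hl.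
  - apply is_lim_seq_const.
Qed.

Lemma sum_n_Cmod_le_Series (a : nat -> C) (N : nat) :
  summable a ->
  (sum_n (fun n => Cmod (a n)) N <= Series (fun n => Cmod (a n)))%R.
Proof.
  intros [l Hl]. rewrite (is_series_unique _ _ Hl).
  apply (is_lim_seq_incr_compare (sum_n (fun n => Cmod (a n))) l); [exact Hl|].
  intro n. rewrite sum_Sn. unfold plus; simpl.
  pose proof (Cmod_ge_0 (a (S n))). lra.
Qed.

Lemma im_le_Cmod (z : C) : (Rabs (Im z) <= Cmod z)%R.
Proof.
  pose proof (Rmax_Cmod z). pose proof (Rmax_r (Rabs (fst z)) (Rabs (snd z))).
  unfold Im; lra.
Qed.

Lemma summable_le (a : nat -> C) (b : nat -> R) :
  (forall n, Cmod (a n) <= b n)%R -> ex_series b -> summable a.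
Proof.
  intros H Hb. apply (ex_series_le (K := R_AbsRing) (V := R_CompleteNormedModule) (fun n => Cmod (a n)) b); [|exact Hb].
  intro n. change (Rabs (Cmod (a n)) <= b n)%R.
  rewrite Rabs_pos_eq by apply Cmod_ge_0. apply H.
Qed.

Lemma summable_Re_abs (a : nat -> C) :
  summable a -> ex_series (fun n => Rabs (Re (a n))).
Proof.
  intro H. apply (ex_series_le (K := R_AbsRing) (V := R_CompleteNormedModule) _ (fun n => Cmod (a n))); [|exact H].
  intro n. change (Rabs (Rabs (Re (a n))) <= Cmod (a n))%R.
  rewrite Rabs_Rabsolu. apply re_le_Cmod.
Qed.

Lemma summable_Im_abs (a : nat -> C) :
  summable a -> ex_series (fun n => Rabs (Im (a n))).
Proof.
  intro H. apply (ex_series_le (K := R_AbsRing) (V := R_CompleteNormedModule) _ (fun n => Cmod (a n))); [|exact H].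
  intro n. change (Rabs (Rabs (Im (a n))) <= Cmod (a n))%R.
  rewrite Rabs_Rabsolu. apply im_le_Cmod.
Qed.

Lemma summable_Re (a : nat -> C) : summable a -> ex_series (fun n => Re (a n)).
Proof. intro H. apply ex_series_Rabs, summable_Re_abs, H. Qed.

Lemma summable_Im (a : nat -> C) : summable a -> ex_series (fun n => Im (a n)).
Proof. intro H. apply ex_series_Rabs, summable_Im_abs, H. Qed.

Lemma summable_plus (a b : nat -> C) :
  summable a -> summable b -> summable (fun n => a n + b n).
Proof.
  intros Ha Hb.
  apply (summable_le _ (fun n => Cmod (a n) + Cmod (b n))%R).
  - intro n. apply Cmod_triangle.
  - exact (ex_series_plus _ _ Ha Hb).
Qed.

Lemma summable_scal (c : C) (a : nat -> C) :
  summable a -> summable (fun n => c * a n).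
Proof.
  intros Ha.
  apply (summable_le _ (fun n => Cmod c * Cmod (a n))%R).
  - intro n. rewrite Cmod_mult. lra.
  - exact (ex_series_scal (Cmod c) _ Ha).
Qed.

Lemma summable_shift (a : nat -> C) : summable a -> summable (shift a).
Proof.
  intro H. apply (ex_series_incr_1 (fun n => Cmod (shift a n))). exact H.
Qed.

Lemma CSeries_ext (a b : nat -> C) :
  (forall n, a n = b n) -> CSeries a = CSeries b.
Proof.
  intro H. unfold CSeries. f_equal; apply Series_ext; intro n; rewrite H; reflexivity.
Qed.

Lemma C_ext (z w : C) : Re z = Re w -> Im z = Im w -> z = w.
Proof. destruct z, w; simpl; congruence. Qed.

Lemma CSeries_plus (a b : nat -> C) :
  summable a -> summable b ->
  CSeries (fun n => a n + b n) = CSeries a + CSeries b.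
Proof.
  intros Ha Hb. unfold CSeries. apply C_ext; simpl.
  - apply Series_plus; apply summable_Re; assumption.
  - apply Series_plus; apply summable_Im; assumption.
Qed.

Lemma CSeries_scal (c : C) (a : nat -> C) :
  summable a -> CSeries (fun n => c * a n) = c * CSeries a.
Proof.
  intros Ha. pose proof (summable_Re a Ha) as HR.
  pose proof (summable_Im a Ha) as HI.
  unfold CSeries. apply C_ext; simpl.
  - rewrite <- !Series_scal_l. rewrite <- Series_minus.
    + reflexivity.
    + exact (ex_series_scal (fst c) _ HR).
    + exact (ex_series_scal (snd c) _ HI).
  - rewrite <- !Series_scal_l. rewrite <- Series_plus.
    + reflexivity.
    + exact (ex_series_scal (fst c) _ HI).
    + exact (ex_series_scal (snd c) _ HR).
Qed.

Lemma CSeries_incr_1 (a : nat -> C) :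
  summable a -> CSeries a = a 0%nat + CSeries (fun n => a (S n)).
Proof.
  intro Ha. unfold CSeries. apply C_ext; simpl.
  - rewrite Series_incr_1 by (apply summable_Re, Ha). reflexivity.
  - rewrite Series_incr_1 by (apply summable_Im, Ha). reflexivity.
Qed.

(** Rotating the sum to the positive real axis by a unit factor reduces the bound
    to the real triangle inequality for the real parts. *)
Lemma Cmod_CSeries_le (a : nat -> C) :
  summable a -> (Cmod (CSeries a) <= Series (fun n => Cmod (a n)))%R.
Proof.
  intro Ha.
  destruct (Ceq_dec (CSeries a) 0) as [H0|H0].
  - rewrite H0, Cmod_0. apply Rle_trans with (2 := sum_n_Cmod_le_Series a 0 Ha).
    rewrite sum_O. apply Cmod_ge_0.
  - set (s := CSeries a) in *.
    assert (Hs : (0 < Cmod s)%R) by (apply Cmod_gt_0; exact H0).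
    set (u := Cconj s / RtoC (Cmod s)).
    assert (Hm : RtoC (Cmod s) <> 0) by (intro E; apply RtoC_inj in E; lra).
    assert (Hu : Cmod u = 1%R).
    { unfold u. rewrite Cmod_div, Cmod_conj, Cmod_R, Rabs_pos_eq by (assumption || lra).
      field; lra. }
    assert (E : u * s = RtoC (Cmod s)).
    { unfold u. transitivity (Cconj s * s / RtoC (Cmod s)); [field; exact Hm|].
      rewrite (Cmult_comm (Cconj s) s), <- Cmod2_conj, RtoC_pow. simpl. field. exact Hm. }
    replace (Cmod s) with (Re (u * s)) by (rewrite E; reflexivity).
    unfold s. rewrite <- CSeries_scal by exact Ha.
    change (Series (fun n => Re (u * a n)) <= Series (fun n => Cmod (a n)))%R.
    apply Rle_trans with (Rabs (Series (fun n => Re (u * a n)))); [apply Rle_abs|].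
    apply Rle_trans with (Series (fun n => Rabs (Re (u * a n)))).
    + apply Series_Rabs, summable_Re_abs, summable_scal, Ha.
    + apply Series_le; [|exact Ha]. intro n; split; [apply Rabs_pos|].
      rewrite <- (Rmult_1_l (Cmod (a n))), <- Hu, <- Cmod_mult. apply re_le_Cmod.
Qed.

Lemma sum_n_first (u : nat -> R) (N : nat) :
  sum_n u (S N) = (u 0%nat + sum_n (fun n => u (S n)) N)%R.
Proof.
  unfold sum_n. rewrite sum_Sn_m by lia. unfold plus; simpl.
  f_equal. symmetry. apply (sum_n_m_S u 0 N).
Qed.

Lemma sum_n_last (u : nat -> R) (N : nat) :
  sum_n u (S N) = (sum_n u N + u (S N))%R.
Proof. rewrite sum_Sn. reflexivity. Qed.

Lemma sum_n_Cmod_ge_0 (a : nat -> C) (N : nat) :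
  (0 <= sum_n (fun n => Cmod (a n)) N)%R.
Proof.
  induction N as [|N IH].
  - rewrite sum_O. apply Cmod_ge_0.
  - rewrite sum_n_last. pose proof (Cmod_ge_0 (a (S N))). lra.
Qed.

Lemma sum_Cmod_conv_le (f g : nat -> C) (N : nat) :
  (sum_n (fun n => Cmod (conv f g n)) N <=
   sum_n (fun n => Cmod (f n)) N * sum_n (fun n => Cmod (g n)) N)%R.
Proof.
  revert f; induction N as [|N IH]; intro f.
  - rewrite !sum_O. simpl. rewrite Cmod_mult. lra.
  - specialize (IH (fun k => f (S k))).
    pose proof (sum_n_Cmod_ge_0 (fun k => f (S k)) N) as Fpos.
    pose proof (Cmod_ge_0 (g (S N))) as Gpos.
    apply Rle_trans with (Cmod (f 0%nat) * sum_n (fun n => Cmod (g n)) (S N)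
      + sum_n (fun n => Cmod (conv (fun k => f (S k)) g n)) N)%R.
    + rewrite !sum_n_first.
      apply Rle_trans with (Cmod (conv f g 0) +
        sum_n (fun n => plus (mult (K := R_Ring) (Cmod (f 0%nat)) (Cmod (g (S n))))
          (Cmod (conv (fun k => f (S k)) g n))) N)%R.
      * apply Rplus_le_compat_l. apply sum_n_m_le. intro n. cbn [conv].
        unfold plus, mult; simpl. rewrite <- Cmod_mult. apply Cmod_triangle.
      * rewrite sum_n_plus.
        rewrite (sum_n_mult_l (K := R_Ring) (Cmod (f 0%nat)) (fun n => Cmod (g (S n)))).
        simpl. rewrite Cmod_mult. unfold mult, plus; simpl. rewrite Rmult_plus_distr_l, Rplus_assoc. apply Rle_refl.
    + rewrite (sum_n_first (fun n => Cmod (f n))), sum_n_last.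
      pose proof (Rmult_le_pos _ _ Fpos Gpos). simpl in *. lra.
Qed.

Lemma summable_conv (f g : nat -> C) :
  summable f -> summable g -> summable (conv f g).
Proof.
  intros Hf Hg.
  apply (summable_of_bounded _ (Series (fun n => Cmod (f n)) * Series (fun n => Cmod (g n)))).
  intro N. apply Rle_trans with (1 := sum_Cmod_conv_le f g N).
  apply Rmult_le_compat; try apply sum_n_Cmod_ge_0;
    apply sum_n_Cmod_le_Series; assumption.
Qed.

Lemma Re_conv (f g : nat -> C) (n : nat) :
  Re (conv f g n) =
  (sum_f_R0 (fun k => Re (f k) * Re (g (n - k)%nat)) n
   - sum_f_R0 (fun k => Im (f k) * Im (g (n - k)%nat)) n)%R.
Proof.
  revert f; induction n as [|n IH]; intro f; [apply re_mult|].
  rewrite (decomp_sum (fun k => Re (f k) * _)%R), (decomp_sum (fun k => Im (f k) * _)%R)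
    by lia. cbn [conv Nat.pred Nat.sub].
  rewrite re_plus, re_mult, IH. ring.
Qed.

Lemma Im_conv (f g : nat -> C) (n : nat) :
  Im (conv f g n) =
  (sum_f_R0 (fun k => Re (f k) * Im (g (n - k)%nat)) n
   + sum_f_R0 (fun k => Im (f k) * Re (g (n - k)%nat)) n)%R.
Proof.
  revert f; induction n as [|n IH]; intro f; [apply im_mult|].
  rewrite (decomp_sum (fun k => Re (f k) * _)%R), (decomp_sum (fun k => Im (f k) * _)%R)
    by lia. cbn [conv Nat.pred Nat.sub].
  rewrite im_plus, im_mult, IH. ring.
Qed.

(** Mertens' theorem for real series, applied to the four products of real and
    imaginary parts. *)
Lemma CSeries_conv (f g : nat -> C) :
  summable f -> summable g -> CSeries (conv f g) = CSeries f * CSeries g.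
Proof.
  intros Hf Hg.
  pose proof (summable_Re_abs f Hf) as Rf. pose proof (summable_Im_abs f Hf) as If.
  pose proof (summable_Re_abs g Hg) as Rg. pose proof (summable_Im_abs g Hg) as Ig.
  assert (prod : forall u v : nat -> R, ex_series (fun n => Rabs (u n)) ->
    ex_series (fun n => Rabs (v n)) ->
    is_series (fun n => sum_f_R0 (fun k => u k * v (n - k)%nat)%R n) (Series u * Series v)%R).
  { intros u v Hu Hv. apply is_series_mult; auto;
    apply Series_correct, ex_series_Rabs; assumption. }
  apply C_ext.
  - rewrite re_mult. unfold CSeries, Re, Im; simpl. apply is_series_unique.
    eapply is_series_ext; [intro n; symmetry; apply Re_conv|].
    exact (is_series_minus _ _ _ _ (prod _ _ Rf Rg) (prod _ _ If Ig)).
  - rewrite im_mult. unfold CSeries, Re, Im; simpl. apply is_series_unique.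
    eapply is_series_ext; [intro n; symmetry; apply Im_conv|].
    exact (is_series_plus _ _ _ _ (prod _ _ Rf Ig) (prod _ _ If Rg)).
Qed.

(** * Power series on the closed unit disk *)

Definition power_series (a : nat -> C) (z : C) : C := CSeries (fun n => a n * z ^ n).

Lemma Cmod_power_term_le (a : nat -> C) (z : C) (n : nat) :
  (Cmod z <= 1)%R -> (Cmod (a n * z ^ n) <= Cmod (a n))%R.
Proof.
  intro Hz. rewrite Cmod_mult, Cmod_pow. rewrite <- (Rmult_1_r (Cmod (a n))) at 2.
  apply Rmult_le_compat_l; [apply Cmod_ge_0|].
  rewrite <- (pow1 n). apply pow_incr. split; [apply Cmod_ge_0|exact Hz].
Qed.

Lemma summable_pow (a : nat -> C) (z : C) :
  (Cmod z <= 1)%R -> summable a -> summable (fun n => a n * z ^ n).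
Proof.
  intros Hz Ha. apply (summable_le _ (fun n => Cmod (a n))); [|exact Ha].
  intro n. apply Cmod_power_term_le, Hz.
Qed.

Lemma power_series_plus (a b : nat -> C) (z : C) :
  (Cmod z <= 1)%R -> summable a -> summable b ->
  power_series (fun n => a n + b n) z = power_series a z + power_series b z.
Proof.
  intros Hz Ha Hb. unfold power_series. rewrite <- CSeries_plus by (apply summable_pow; assumption).
  apply CSeries_ext. intro n. ring.
Qed.

Lemma power_series_scal (c : C) (a : nat -> C) (z : C) :
  (Cmod z <= 1)%R -> summable a -> power_series (fun n => c * a n) z = c * power_series a z.
Proof.
  intros Hz Ha. unfold power_series. rewrite <- CSeries_scal by (apply summable_pow; assumption).
  apply CSeries_ext. intro n. ring.
Qed.

Lemma power_series_shift (a : nat -> C) (z : C) :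
  (Cmod z <= 1)%R -> summable a -> power_series (shift a) z = z * power_series a z.
Proof.
  intros Hz Ha. unfold power_series.
  rewrite CSeries_incr_1 by (apply summable_pow, summable_shift; assumption).
  rewrite <- CSeries_scal by (apply summable_pow; assumption). simpl.
  rewrite Cmult_0_l, Cplus_0_l. apply CSeries_ext. intro n. ring.
Qed.

Lemma power_series_conv (a b : nat -> C) (z : C) :
  (Cmod z <= 1)%R -> summable a -> summable b ->
  power_series (conv a b) z = power_series a z * power_series b z.
Proof.
  intros Hz Ha Hb. unfold power_series.
  rewrite <- CSeries_conv by (apply summable_pow; assumption).
  apply CSeries_ext. intro n. symmetry. apply conv_pow.
Qed.

Lemma Cmod_power_series_le (a : nat -> C) (z : C) :
  (Cmod z <= 1)%R -> summable a -> (Cmod (power_series a z) <= Series (fun n => Cmod (a n)))%R.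
Proof.
  intros Hz Ha. apply Rle_trans with (1 := Cmod_CSeries_le _ (summable_pow a z Hz Ha)).
  apply Series_le; [|exact Ha]. intro n. split; [apply Cmod_ge_0|].
  apply Cmod_power_term_le, Hz.
Qed.

Lemma power_series_0 (a : nat -> C) : summable a -> power_series a 0 = a 0%nat.
Proof.
  intro Ha. unfold power_series.
  rewrite CSeries_incr_1 by (apply summable_pow; [rewrite Cmod_0; lra|assumption]).
  rewrite (CSeries_ext _ (fun n => 0 * a n)) by (intro n; rewrite Cpow_S; ring).
  rewrite CSeries_scal by assumption. simpl. ring.
Qed.

(** * Complex derivative of a power series *)

Definition derive_coeff (a : nat -> C) (n : nat) : C := INR (S n) * a (S n).

Lemma pow_diff_le (z w : C) (n : nat) :
  (Cmod z <= 1)%R -> (Cmod w <= 1)%R ->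
  (Cmod (w ^ n - z ^ n) <= INR n * Cmod (w - z))%R.
Proof.
  intros Hz Hw. induction n as [|n IH].
  - simpl. replace (1 - 1) with (RtoC 0) by ring. rewrite Cmod_0. lra.
  - replace (w ^ S n - z ^ S n) with (w * (w ^ n - z ^ n) + z ^ n * (w - z))
      by (rewrite !Cpow_S; ring).
    apply Rle_trans with (1 := Cmod_triangle _ _).
    rewrite !Cmod_mult, Cmod_pow, S_INR.
    assert (Cmod z ^ n <= 1)%R
      by (rewrite <- (pow1 n); apply pow_incr; split; [apply Cmod_ge_0|exact Hz]).
    pose proof (Cmod_ge_0 w). pose proof (Cmod_ge_0 (w - z)).
    pose proof (Cmod_ge_0 (w ^ n - z ^ n)).
    nra.
Qed.

(** Second-order Taylor remainder of the monomial of degree [n + 2]; the step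
    multiplies the previous remainder by [w] and adds
    [(n + 2) z ^ (n + 1) (w - z) ^ 2]. *)
Lemma pow_taylor_le (z w : C) (rho : R) (n : nat) :
  (Cmod z <= rho)%R -> (Cmod w <= rho)%R ->
  (Cmod (w ^ S (S n) - z ^ S (S n) - (w - z) * (INR (S (S n)) * z ^ S n))
   <= INR (S n) * INR (S (S n)) * rho ^ n * Cmod (w - z) ^ 2)%R.
Proof.
  intros Hz Hw. pose proof (Cmod_ge_0 z) as Pz. pose proof (Cmod_ge_0 w) as Pw.
  induction n as [|n IH].
  - replace (w ^ 2 - z ^ 2 - (w - z) * (INR 2 * z ^ 1)) with ((w - z) * (w - z))
      by (rewrite !RtoC_INR_S; simpl; ring).
    rewrite Cmod_mult. simpl. pose proof (pow2_ge_0 (Cmod (w - z))). simpl in *. lra.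
  - replace (w ^ S (S (S n)) - z ^ S (S (S n)) - (w - z) * (INR (S (S (S n))) * z ^ S (S n)))
      with (w * (w ^ S (S n) - z ^ S (S n) - (w - z) * (INR (S (S n)) * z ^ S n))
            + INR (S (S n)) * z ^ S n * ((w - z) * (w - z)))
      by (rewrite (RtoC_INR_S (S (S n))), !Cpow_S; ring).
    apply Rle_trans with (1 := Cmod_triangle _ _).
    rewrite !Cmod_mult, Cmod_pow, Cmod_R, Rabs_pos_eq by apply pos_INR.
    assert (P : (Cmod z ^ S n <= rho ^ S n)%R) by (apply pow_incr; lra).
    set (d := Cmod (w - z)) in *.
    assert (Hd : (0 <= d * d)%R) by apply Rle_0_sqr.
    set (E := Cmod (w ^ S (S n) - z ^ S (S n) - (w - z) * (INR (S (S n)) * z ^ S n))) in *.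
    assert (HE : (0 <= E)%R) by apply Cmod_ge_0.
    assert (Hr : (0 <= rho ^ S n)%R) by (apply pow_le; lra).
    assert (H1 : (Cmod w * E <= rho * (INR (S n) * INR (S (S n)) * rho ^ n * d ^ 2))%R)
      by (apply Rmult_le_compat; lra).
    assert (H2 : (INR (S (S n)) * Cmod z ^ S n * (d * d) <= INR (S (S n)) * rho ^ S n * (d * d))%R).
    { apply Rmult_le_compat_r; [exact Hd|]. apply Rmult_le_compat_l; [apply pos_INR|exact P]. }
    apply Rle_trans with (INR (S (S n)) * INR (S (S n)) * rho ^ S n * (d * d))%R.
    + rewrite (S_INR (S n)) at 3. simpl (rho ^ S n)%R in *. simpl (d ^ 2)%R in *. lra.
    + replace (d ^ 2)%R with (d * d)%R by ring.
      apply Rmult_le_compat_r; [exact Hd|]. apply Rmult_le_compat_r; [exact Hr|].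
      apply Rmult_le_compat_l; [apply pos_INR|]. apply le_INR. lia.
Qed.

(** Gives access to the real theory of the convergence radius, which differentiates
    a majorant series without changing its radius. *)
Lemma CV_radius_of_summable (a : nat -> C) (rho : R) :
  summable a -> (0 <= rho < 1)%R ->
  Rbar_lt (Rabs rho) (CV_radius (fun n => Cmod (a n))).
Proof.
  intros Ha Hr. apply Rbar_lt_le_trans with (Finite 1).
  - simpl. rewrite Rabs_pos_eq; lra.
  - unfold CV_radius, Lub_Rbar. destruct (ex_lub_Rbar (CV_disk (fun n => Cmod (a n)))) as [l [Hl Hl']]. simpl.
    apply Hl. unfold CV_disk.
    apply (ex_series_ext (fun n => Cmod (a n))); [|exact Ha].
    intro n. rewrite pow1, Rmult_1_r, Rabs_pos_eq; [reflexivity|apply Cmod_ge_0].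
Qed.

Lemma summable_derive_coeff_pow (a : nat -> C) (z : C) :
  summable a -> (Cmod z < 1)%R -> summable (fun n => derive_coeff a n * z ^ n).
Proof.
  intros Ha Hz. pose proof (Cmod_ge_0 z).
  assert (H1 : ex_series (fun n => Rabs (PS_derive (fun n => Cmod (a n)) n * Cmod z ^ n))).
  { apply CV_disk_inside. rewrite CV_radius_derive.
    apply CV_radius_of_summable; [exact Ha|lra]. }
  apply (summable_le _ _ ) with (2 := H1). intro n.
  rewrite Cmod_mult, Cmod_pow. unfold derive_coeff, PS_derive.
  rewrite Cmod_mult, Cmod_R, (Rabs_pos_eq (INR (S n))) by apply pos_INR.
  apply Rle_abs.
Qed.

(** The remainders of the monomials sum to the second derivative of the majorant
    series [sum |a n| rho ^ n], which converges because [rho < 1]. *)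
Lemma power_series_taylor (a : nat -> C) (rho : R) :
  summable a -> (0 <= rho < 1)%R ->
  exists M, (0 <= M)%R /\ forall z w, (Cmod z <= rho)%R -> (Cmod w <= rho)%R ->
    (Cmod (power_series a w - power_series a z - (w - z) * power_series (derive_coeff a) z) <= M * Cmod (w - z) ^ 2)%R.
Proof.
  intros Ha Hrho.
  set (b := fun n => (PS_derive (PS_derive (fun n => Cmod (a n))) n * rho ^ n)%R).
  assert (Hb0 : forall n, (0 <= b n)%R).
  { intro n. unfold b, PS_derive. repeat apply Rmult_le_pos;
      try apply pos_INR; try apply Cmod_ge_0. apply pow_le; lra. }
  assert (Hb : ex_series b).
  { apply ex_series_Rabs. apply CV_disk_inside. rewrite !CV_radius_derive.
    apply CV_radius_of_summable; assumption. }
  exists (Series b). split.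
  { rewrite <- (Rmult_0_l (Series b)), <- Series_scal_l.
    apply Series_le; [|exact Hb]. intro n. specialize (Hb0 n). split; lra. }
  intros z w Hz Hw.
  assert (Sz : summable (fun n => a n * z ^ n)) by (apply summable_pow; [lra|exact Ha]).
  assert (Sw : summable (fun n => a n * w ^ n)) by (apply summable_pow; [lra|exact Ha]).
  assert (Sd : summable (fun n => derive_coeff a n * z ^ n)) by (apply summable_derive_coeff_pow; [exact Ha|lra]).
  set (t := fun n => a n * w ^ n + (-1) * (a n * z ^ n)
             + (- (w - z)) * shift (fun n => derive_coeff a n * z ^ n) n).
  assert (St : summable t).
  { apply summable_plus; [apply summable_plus|]; [|apply summable_scal|apply summable_scal, summable_shift]; assumption. }
  assert (E : power_series a w - power_series a z - (w - z) * power_series (derive_coeff a) z = CSeries (fun n => t (S (S n)))).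
  { transitivity (CSeries t).
    - unfold t. rewrite CSeries_plus, CSeries_plus, !CSeries_scal;
        try assumption; try apply summable_plus; try apply summable_scal; try apply summable_shift; try assumption.
      rewrite (CSeries_incr_1 (shift _)) by (apply summable_shift; assumption).
      simpl (shift _ 0). unfold power_series.
      change (CSeries (fun n => shift (fun n0 => derive_coeff a n0 * z ^ n0) (S n)))
        with (CSeries (fun n => derive_coeff a n * z ^ n)). ring.
    - rewrite CSeries_incr_1, CSeries_incr_1 by
        (try exact St; apply (ex_series_incr_1 (fun n => Cmod (t n))); exact St).
      unfold t, derive_coeff. simpl. ring. }
  rewrite E.
  assert (St2 : summable (fun n => t (S (S n)))).
  { apply (ex_series_incr_1 (fun n => Cmod (t (S n)))), (ex_series_incr_1 (fun n => Cmod (t n))); exact St. }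
  apply Rle_trans with (1 := Cmod_CSeries_le _ St2).
  rewrite <- Series_scal_r. apply Series_le.
  - intro n. split; [apply Cmod_ge_0|].
    replace (t (S (S n)))
      with (a (S (S n)) * (w ^ S (S n) - z ^ S (S n) - (w - z) * (INR (S (S n)) * z ^ S n)))
      by (unfold t, derive_coeff; cbn [shift]; ring).
    unfold b, PS_derive. rewrite Cmod_mult.
    pose proof (pow_taylor_le z w rho n Hz Hw) as P.
    pose proof (Cmod_ge_0 (a (S (S n)))) as Q.
    apply Rle_trans with (1 := Rmult_le_compat_l _ _ _ Q P). right. ring.
  - exact (ex_series_scal_r _ _ Hb).
Qed.

Lemma is_derive_power_series (a : nat -> C) (z : C) :
  summable a -> (Cmod z < 1)%R ->
  is_derive (K := C_AbsRing) (V := C_NormedModule) (power_series a) z (power_series (derive_coeff a) z).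
Proof.
  intros Ha Hz. pose proof (Cmod_ge_0 z) as Pz.
  set (rho := ((1 + Cmod z) / 2)%R).
  destruct (power_series_taylor a rho Ha) as [M [HM H]]; [unfold rho; lra|].
  split.
  - apply is_linear_scal_l.
  - intros x Hx.
    assert (Ex : z = x) by exact (is_filter_lim_locally_unique (V := AbsRing_NormedModule C_AbsRing) _ _ Hx).
    subst x. intro eps.
    assert (Hd : (0 < Rmin ((1 - Cmod z) / 2) (eps / (M + 1)))%R).
    { apply Rmin_pos; [lra|]. apply Rdiv_lt_0_compat; [apply cond_pos|lra]. }
    exists (mkposreal _ Hd). intros w Hw.
    change (Cmod (w - z) < Rmin ((1 - Cmod z) / 2) (eps / (M + 1)))%R in Hw.
    pose proof (Rmin_l ((1 - Cmod z) / 2) (eps / (M + 1))).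
    pose proof (Rmin_r ((1 - Cmod z) / 2) (eps / (M + 1))).
    assert (Hw1 : (Cmod w <= rho)%R).
    { replace w with (z + (w - z)) by ring.
      apply Rle_trans with (1 := Cmod_triangle _ _). unfold rho. lra. }
    change (Cmod (power_series a w - power_series a z - (w - z) * power_series (derive_coeff a) z) <= eps * Cmod (w - z))%R.
    apply Rle_trans with (M * Cmod (w - z) ^ 2)%R; [apply H; [unfold rho; lra|exact Hw1]|].
    pose proof (Cmod_ge_0 (w - z)) as Pd.
    assert (M * Cmod (w - z) <= eps)%R.
    { apply Rle_trans with ((M + 1) * (eps / (M + 1)))%R; [|right; field; lra].
      apply Rmult_le_compat; lra. }
    replace (M * Cmod (w - z) ^ 2)%R with (M * Cmod (w - z) * Cmod (w - z))%R by ring.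
    apply Rmult_le_compat_r; assumption.
Qed.

(** * The complex exponential as a power series *)

Lemma INR_fact_C_neq_0 (n : nat) : RtoC (INR (fact n)) <> 0.
Proof. intro E. apply RtoC_inj in E. exact (INR_fact_neq_0 n E). Qed.

Lemma INR_S_C_neq_0 (n : nat) : RtoC (INR (S n)) <> 0.
Proof. intro E. apply RtoC_inj in E. exact (not_0_INR (S n) (Nat.neq_succ_0 n) E). Qed.

Lemma exp_term_S (x : C) (n : nat) :
  INR (S n) * (x ^ S n / INR (fact (S n))) = x * (x ^ n / INR (fact n)).
Proof.
  rewrite fact_simpl, mult_INR, RtoC_mult, Cpow_S. field.
  split; [apply INR_fact_C_neq_0|apply INR_S_C_neq_0].
Qed.

Lemma theta_exp_term (x : C) :
  theta (fun n => x ^ n / INR (fact n)) = fun n => x * shift (fun n => x ^ n / INR (fact n)) n.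
Proof.
  apply functional_extensionality. intros [|n]; unfold theta.
  - simpl. ring.
  - apply exp_term_S.
Qed.

(** Both sides satisfy [n u n = (x + y) u (n - 1)], because [theta] is a
    derivation; this replaces the binomial theorem. *)
Lemma conv_exp (x y : C) (n : nat) :
  conv (fun n => x ^ n / INR (fact n)) (fun n => y ^ n / INR (fact n)) n
  = (x + y) ^ n / INR (fact n).
Proof.
  induction n as [|n IH]; [simpl; field; apply C1_nz|].
  pose proof (theta_conv (fun n => x ^ n / INR (fact n)) (fun n => y ^ n / INR (fact n)) (S n)) as H.
  rewrite !theta_exp_term, conv_scal_l, conv_scal_r, conv_shift_l, conv_shift_r in H.
  unfold theta in H. simpl (shift _ _) in H. rewrite IH, <- Cmult_plus_distr_r, <- exp_term_S in H.
  apply (f_equal (fun c => / INR (S n) * c)) in H.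
  rewrite !Cmult_assoc, Cinv_l, !Cmult_1_l in H by apply INR_S_C_neq_0. exact H.
Qed.

Lemma summable_exp (x : C) : summable (fun n => x ^ n / INR (fact n)).
Proof.
  apply (ex_series_ext (fun n => / INR (fact n) * Cmod x ^ n)%R).
  - intro n. rewrite Cmod_div by apply INR_fact_C_neq_0.
    rewrite Cmod_pow, Cmod_R, Rabs_pos_eq by apply pos_INR. apply Rmult_comm.
  - exists (exp (Cmod x)). apply is_pseries_R, is_exp_Reals.
Qed.

Definition exp_series (z : C) : C := CSeries (fun n => z ^ n / INR (fact n)).

Lemma exp_series_plus (x y : C) :
  exp_series (x + y) = exp_series x * exp_series y.
Proof.
  unfold exp_series. rewrite <- CSeries_conv by apply summable_exp.
  apply CSeries_ext. intro n. symmetry. apply conv_exp.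
Qed.

Lemma is_series_0 (u : nat -> R) : (forall n, u n = 0%R) -> is_series u 0%R.
Proof.
  intro H. apply (is_lim_seq_ext (fun _ => 0%R) (sum_n u) 0%R); [|apply is_lim_seq_const].
  intro N. induction N as [|N IH].
  - rewrite sum_O. symmetry. apply H.
  - rewrite sum_n_last, <- IH, H. symmetry. apply Rplus_0_r.
Qed.

Lemma exp_series_R (x : R) : exp_series x = RtoC (exp x).
Proof.
  unfold exp_series.
  rewrite (CSeries_ext _ (fun n => RtoC (/ INR (fact n) * x ^ n))).
  2:{ intro n. rewrite <- RtoC_pow, <- RtoC_div by apply INR_fact_neq_0.
      f_equal. apply Rmult_comm. }
  unfold CSeries. apply C_ext; simpl; apply is_series_unique.
  - apply is_pseries_R, is_exp_Reals.
  - apply is_series_0. reflexivity.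
Qed.

Lemma Ci_pow_even (k : nat) : Ci ^ (2 * k) = RtoC ((-1) ^ k).
Proof.
  rewrite Cpow_mult_r. replace (Ci ^ 2) with (RtoC (-1)).
  - symmetry. apply RtoC_pow.
  - apply C_ext; simpl; ring.
Qed.

Lemma Ci_pow_odd (k : nat) : Ci ^ (2 * k + 1) = RtoC ((-1) ^ k) * Ci.
Proof. rewrite Cpow_add_r, Ci_pow_even, Cpow_1_r. reflexivity. Qed.

Lemma exp_series_imag (y : R) : exp_series (Ci * y) = (cos y, sin y).
Proof.
  assert (T : forall n, (Ci * y) ^ n / INR (fact n)
                        = RtoC (y ^ n / INR (fact n)) * Ci ^ n).
  { intro n. rewrite Cpow_mult_l, <- RtoC_pow, RtoC_div by apply INR_fact_neq_0.
    field. apply INR_fact_C_neq_0. }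
  unfold exp_series. rewrite (CSeries_ext _ _ T).
  unfold CSeries. f_equal; apply is_series_unique.
  - apply (is_series_ext (fun n => Re (Ci ^ n) / INR (fact n) * y ^ n)%R).
    { intro n. rewrite re_scal_l. unfold Rdiv. simpl. ring. }
    apply is_pseries_R. replace (cos y) with (cos y + y * 0)%R by ring.
    apply is_pseries_odd_even.
    + apply is_pseries_R. unfold cos. destruct (exist_cos (Rsqr y)) as [l Hl].
      apply (is_series_ext (fun i => cos_n i * Rsqr y ^ i)%R).
      * intro n. rewrite Ci_pow_even, re_RtoC. unfold cos_n.
        rewrite <- Rsqr_pow2. reflexivity.
      * apply is_series_Reals. exact Hl.
    + apply is_pseries_R. apply (is_series_0). intro n.
      rewrite Ci_pow_odd. simpl. unfold Rdiv. ring.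
  - apply (is_series_ext (fun n => Im (Ci ^ n) / INR (fact n) * y ^ n)%R).
    { intro n. rewrite im_scal_l. unfold Rdiv. simpl. ring. }
    apply is_pseries_R. unfold sin. destruct (exist_sin (Rsqr y)) as [l Hl].
    replace (y * l)%R with (0 + y * l)%R by ring.
    apply is_pseries_odd_even.
    + apply is_pseries_R. apply (is_series_0). intro n.
      rewrite Ci_pow_even, im_RtoC. unfold Rdiv. ring.
    + apply is_pseries_R.
      apply (is_series_ext (fun i => sin_n i * Rsqr y ^ i)%R).
      * intro n. rewrite Ci_pow_odd. unfold sin_n.
        rewrite im_scal_l. rewrite <- Rsqr_pow2. simpl (Im Ci).
        rewrite Rmult_1_r. reflexivity.
      * apply is_series_Reals. exact Hl.
Qed.

Lemma Cexp_series (z : C) : Cexp z = CSeries (fun n => z ^ n / INR (fact n)).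
Proof.
  change (Cexp z = exp_series z).
  replace z with (Re z + Ci * Im z) at 2 by (apply C_ext; simpl; ring).
  rewrite exp_series_plus, exp_series_R, exp_series_imag.
  apply C_ext; unfold Cexp; simpl; ring.
Qed.

Lemma Cexp_opp_l (z : C) : Cexp (- z) * Cexp z = 1.
Proof.
  rewrite !Cexp_series. change (exp_series (- z) * exp_series z = 1).
  rewrite <- exp_series_plus. replace (- z + z) with (RtoC 0) by ring.
  rewrite exp_series_R, exp_0. reflexivity.
Qed.

(** * Coulomb coefficients and the Riccati equation *)

Definition conv_unit (n : nat) : C := match n with O => 1 | S _ => 0 end.

Lemma conv_0_r (f : nat -> C) (n : nat) : conv f (fun _ => 0) n = 0.
Proof.
  rewrite (conv_ext_le f f _ (fun k => 0 * 0)) by (intros; ring).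
  rewrite conv_scal_r. ring.
Qed.

Lemma conv_unit_l (f : nat -> C) (n : nat) : conv conv_unit f n = f n.
Proof.
  destruct n as [|n]; simpl; [ring|].
  rewrite (conv_ext_le _ (fun k => 0 * conv_unit k) f f) by (intros; ring).
  rewrite conv_scal_l. ring.
Qed.

Lemma shift_ext (f g : nat -> C) (n : nat) :
  (forall k, f k = g k) -> shift f n = shift g n.
Proof. intro H. destruct n; simpl; [reflexivity|apply H]. Qed.

(** The numbers [a_{L,n}], from the recurrence satisfied by the Frobenius solution
    of [z^2 g'' + 2 L z g' + (z^2 - 2 eta z - 2 L) g = 0]. *)
Fixpoint coulomb_coeff (eta L : C) (n : nat) : C :=
  match n with
  | O => 1
  | S m =>
      (2 * eta * coulomb_coeff eta L m
       - match m with O => 0 | S p => coulomb_coeff eta L p end)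
      / (INR (S m) * (2 * L + 2 + INR m))
  end.

Lemma coulomb_coeff_S (eta L : C) (n : nat) :
  2 * L + 2 + INR n <> 0 ->
  (2 * L + 2 + INR n) * (INR (S n) * coulomb_coeff eta L (S n))
  = 2 * eta * coulomb_coeff eta L n - shift (coulomb_coeff eta L) n.
Proof.
  intro H.
  change (coulomb_coeff eta L (S n)) with
    ((2 * eta * coulomb_coeff eta L n - shift (coulomb_coeff eta L) n)
      / (INR (S n) * (2 * L + 2 + INR n))).
  field. split; [exact H|apply INR_S_C_neq_0].
Qed.

(** The polynomial [2 eta - z]. *)
Definition riccati_rhs (eta : C) (n : nat) : C := 2 * eta * conv_unit n + (-1) * shift conv_unit n.

(** The Riccati recursion needs all earlier coefficients at once, so the recursion
    builds the function that is correct below [n] and zero from [n] on. *)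
Fixpoint riccati_prefix (eta L : C) (n : nat) : nat -> C :=
  match n with
  | O => fun _ => 0
  | S m => fun k =>
      if (k =? m)%nat
      then (riccati_rhs eta m
            - shift (conv (riccati_prefix eta L m) (riccati_prefix eta L m)) m)
           / (2 * L + 2 + INR m)
      else riccati_prefix eta L m k
  end.

(** Coefficients of [r] where [z g' / g = 1 + z r]: substituting this into the
    differential equation of [g] gives [theta r + (2 L + 2) r + z r^2 = 2 eta - z]. *)
Definition riccati_coeff (eta L : C) (n : nat) : C := riccati_prefix eta L (S n) n.

Lemma riccati_prefix_lt (eta L : C) (n k : nat) :
  (k < n)%nat -> riccati_prefix eta L n k = riccati_coeff eta L k.
Proof.
  induction n as [|n IH]; intro H; [lia|].
  destruct (Nat.eq_dec k n) as [->|Hk]; [reflexivity|].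
  cbn [riccati_prefix]. rewrite (proj2 (Nat.eqb_neq k n) Hk). apply IH. lia.
Qed.

Lemma riccati_eq (eta L : C) (n : nat) :
  2 * L + 2 + INR n <> 0 ->
  (2 * L + 2 + INR n) * riccati_coeff eta L n
  = riccati_rhs eta n - shift (conv (riccati_coeff eta L) (riccati_coeff eta L)) n.
Proof.
  intro H. unfold riccati_coeff at 1. cbn [riccati_prefix].
  rewrite Nat.eqb_refl.
  replace (shift (conv (riccati_prefix eta L n) (riccati_prefix eta L n)) n)
    with (shift (conv (riccati_coeff eta L) (riccati_coeff eta L)) n).
  - field. exact H.
  - destruct n as [|n]; cbn [shift]; [reflexivity|].
    apply conv_ext_le; intros; symmetry; apply riccati_prefix_lt; lia.
Qed.

(** The defect [d = z r a - theta a] solves the homogeneous equation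
    [theta d + (2 L + 1) d = - z r d], by the second-order equation for [a] and the
    Riccati equation for [r]. Its coefficient [n + 1] is determined by those up to
    [n], and the coefficient of index 0 vanishes, so [d = 0]. *)
Lemma theta_coulomb_coeff (eta L : C) (n : nat) :
  (forall k, 2 * L + 2 + INR k <> 0) ->
  theta (coulomb_coeff eta L) n
  = shift (conv (riccati_coeff eta L) (coulomb_coeff eta L)) n.
Proof.
  intro HD. set (a := coulomb_coeff eta L). set (r := riccati_coeff eta L).
  set (d := fun n => shift (conv r a) n + (-1) * theta a n).
  assert (rec : forall m, (2 * L + 2 + INR m) * d (S m) = - conv r d m).
  { intro m. unfold d.
    transitivity ((2 * L + 2) * conv r a m + theta (conv r a) m
                  - (2 * L + 2 + INR m) * (INR (S m) * a (S m))).
    { cbn [shift]. unfold theta. ring. }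
    unfold a at 3. rewrite coulomb_coeff_S by apply HD. fold a.
    rewrite theta_conv.
    transitivity (conv (fun k => (2 * L + 2) * r k + theta r k) a m
                  + conv r (theta a) m - (2 * eta * a m - shift a m)).
    { rewrite conv_plus_l, conv_scal_l. ring. }
    rewrite (conv_ext_le _ (fun k => riccati_rhs eta k + (-1) * shift (conv r r) k) a a).
    2:{ intros k _. transitivity ((2 * L + 2 + INR k) * r k); [unfold theta; ring|].
        unfold r. rewrite riccati_eq by apply HD. ring. }
    2: reflexivity.
    unfold riccati_rhs.
    rewrite !conv_plus_l, !conv_scal_l, !conv_shift_l, conv_unit_l.
    rewrite conv_plus_r, conv_scal_r, conv_shift_r.
    rewrite (shift_ext _ _ _ (conv_unit_l a)), (shift_ext _ _ _ (conv_assoc r r a)).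
    ring. }
  assert (Hd : forall n, d n = 0).
  { intro m. induction m as [m IH] using (well_founded_induction Wf_nat.lt_wf).
    destruct m as [|m].
    - unfold d, theta. simpl. ring.
    - assert (E : (2 * L + 2 + INR m) * d (S m) = 0).
      { rewrite rec, (conv_ext_le r r d (fun _ => 0)).
        - rewrite conv_0_r. ring.
        - reflexivity.
        - intros k Hk. apply IH. lia. }
      apply (f_equal (fun c => / (2 * L + 2 + INR m) * c)) in E.
      rewrite Cmult_assoc, Cinv_l, Cmult_1_l, Cmult_0_r in E by apply HD. exact E. }
  specialize (Hd n). unfold d in Hd.
  transitivity (shift (conv r a) n - (shift (conv r a) n + (-1) * theta a n)); [ring|].
  rewrite Hd. ring.
Qed.

(** * The Kummer form of the Coulomb series *)

(** Coefficients of [e ^ (i z)]. *)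
Definition exp_i_coeff (n : nat) : C := Ci ^ n / INR (fact n).

(** Applying [theta] twice to [e ^ (i z) a (z)] and using the recurrence of [a] gives
    Kummer's equation, hence the two-term recurrence that characterizes the
    coefficients of [1F1 (L + 1 - i eta, 2 L + 2; 2 i z)]. Expanding [1F1] as this
    product, rather than [a] as [e ^ (- i z) 1F1], makes the convergence of the Kummer
    series a consequence of that of [a]. *)
Lemma kummer_coeff (eta L : C) (n : nat) :
  (forall k, 2 * L + 2 + INR k <> 0) ->
  pochhammer (L + 1 - Ci * eta) n / (pochhammer (2 * L + 2) n * INR (fact n))
    * (2 * Ci) ^ n
  = conv exp_i_coeff (coulomb_coeff eta L) n.
Proof.
  intro HD. set (a := coulomb_coeff eta L).
  assert (Ci2 : Ci * Ci = -1) by (apply C_ext; simpl; ring).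
  assert (rec : forall m, (2 * L + 2 + INR m) * (INR (S m) * conv exp_i_coeff a (S m))
    = 2 * Ci * (L + 1 - Ci * eta + INR m) * conv exp_i_coeff a m).
  { intro m.
    set (f := conv exp_i_coeff a).
    assert (T1 : forall n, theta f n = Ci * shift f n + conv exp_i_coeff (theta a) n).
    { intro k. unfold f. rewrite theta_conv. f_equal.
      unfold exp_i_coeff. rewrite theta_exp_term, conv_scal_l, conv_shift_l. reflexivity. }
    set (h := conv exp_i_coeff (theta a)).
    assert (T2 : forall n, theta h n = Ci * shift h n + conv exp_i_coeff (theta (theta a)) n).
    { intro k. unfold h. rewrite theta_conv. f_equal.
      unfold exp_i_coeff. rewrite theta_exp_term, conv_scal_l, conv_shift_l. reflexivity. }
    (* the differential equation of [a], multiplied by [e ^ (i z)] *)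
    assert (T3 : conv exp_i_coeff (fun k => (2 * L + 1) * theta a k + theta (theta a) k) (S m)
                 = 2 * eta * f m - shift f m).
    { rewrite (conv_ext_le exp_i_coeff exp_i_coeff _
        (shift (fun k => 2 * eta * a k + (-1) * shift a k))).
      - rewrite conv_shift_r. cbn [shift].
        rewrite conv_plus_r, !conv_scal_r, conv_shift_r. unfold f. ring.
      - reflexivity.
      - intros [|k] _.
        + unfold theta. simpl. ring.
        + cbn [shift].
          transitivity (2 * eta * a k - shift a k); [|ring].
          unfold a. rewrite <- coulomb_coeff_S by apply HD. unfold theta.
          rewrite RtoC_INR_S. ring. }
    rewrite conv_plus_r, conv_scal_r in T3. fold h in T3.
    pose proof (T1 (S m)) as E1. pose proof (T2 (S m)) as E2. pose proof (T1 m) as E3.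
    fold h in E1, E3. cbn [shift] in E1, E2.
    unfold theta in E1, E3. change (theta h (S m)) with (INR (S m) * h (S m)) in E2.
    assert (F1 : h (S m) = INR (S m) * f (S m) - Ci * f m) by (rewrite E1; ring).
    assert (F3 : h m = INR m * f m - Ci * shift f m) by (rewrite E3; ring).
    assert (F2 : conv exp_i_coeff (theta (theta a)) (S m) = INR (S m) * h (S m) - Ci * h m)
      by (rewrite E2; ring).
    rewrite F2, F1, F3 in T3.
    rewrite RtoC_INR_S in *.
    transitivity ((2 * L + 1) * ((INR m + 1) * f (S m) - Ci * f m) +
     ((INR m + 1) * ((INR m + 1) * f (S m) - Ci * f m) - Ci * (INR m * f m - Ci * shift f m))
     + (2 * L + 2 + 2 * INR m) * Ci * f m - (Ci * Ci) * shift f m); [ring|].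
    rewrite T3, Ci2.
    transitivity (2 * (- (-1)) * eta * f m + (2 * L + 2 + 2 * INR m) * Ci * f m); [ring|].
    rewrite <- Ci2. ring. }
  induction n as [|n IH].
  - simpl. unfold exp_i_coeff, a. simpl. field.
  - assert (Hp : forall k, pochhammer (2 * L + 2) k <> 0).
    { induction k as [|k IHk]; simpl; [apply C1_nz|].
      apply Cmult_neq_0; [exact IHk|apply HD]. }
    assert (E : conv exp_i_coeff a (S n) = 2 * Ci * (L + 1 - Ci * eta + INR n) * conv exp_i_coeff a n
       / ((2 * L + 2 + INR n) * INR (S n))).
    { rewrite <- rec. field. split; [apply INR_S_C_neq_0|apply HD]. }
    rewrite E, <- IH. cbn [pochhammer].
    rewrite fact_simpl, mult_INR, RtoC_mult, Cpow_S. field.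
    repeat split; try apply INR_S_C_neq_0; try apply INR_fact_C_neq_0; auto.
Qed.

(** * Coefficient estimates *)

Lemma sqrt2_bounds : (1.41421 < sqrt 2 < 1.41422)%R /\ (sqrt 2 * sqrt 2 = 2)%R.
Proof.
  pose proof (sqrt_pos 2). pose proof (sqrt_sqrt 2 ltac:(lra)).
  split; [split|assumption]; nra.
Qed.

(** The constant rounds [(sqrt 2 / 4) / (sqrt 2 - 1) = 0.8535...] up. *)
Lemma Cmod_parameter_lt (e d : R) :
  (0 <= e -> 0 <= d -> (sqrt 2 - 1) * d + e < sqrt 2 / 4 -> d < 0.86)%R.
Proof. intros. destruct sqrt2_bounds as [[? ?] ?]. nra. Qed.

(** With [s = sqrt 2] and [e] at its largest value [s / 4 - (s - 1) d], clearing
    denominators leaves [17 s - 24 + d (7 - 19 s / 4) > 0], where [17 s > 24] because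
    [2 * 17 ^ 2 = 578 > 24 ^ 2 = 576]. *)
Lemma riccati_fixpoint_lt (e d : R) :
  (0 <= e -> 0 <= d -> (sqrt 2 - 1) * d + e < sqrt 2 / 4 ->
   e / (3 - d) + (1 + (sqrt 2 - 1) ^ 2) / (4 - d) < sqrt 2 - 1)%R.
Proof.
  intros He Hd H. pose proof (Cmod_parameter_lt e d He Hd H) as Hd1.
  destruct sqrt2_bounds as [[B1 B2] B3]. set (s := sqrt 2) in *.
  apply (Rmult_lt_reg_r ((3 - d) * (4 - d))); [nra|].
  replace ((e / (3 - d) + (1 + (s - 1) ^ 2) / (4 - d)) * ((3 - d) * (4 - d)))%R
    with (e * (4 - d) + (4 - 2 * s) * (3 - d))%R.
  2:{ replace ((s - 1) ^ 2)%R with (s * s - 2 * s + 1)%R by ring. rewrite B3. field. lra. }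
  assert (e * (4 - d) <= (s / 4 - (s - 1) * d) * (4 - d))%R
    by (apply Rmult_le_compat_r; lra).
  assert (0 < 17 * s - 24 + d * (7 - 4.75 * s))%R by nra.
  nra.
Qed.

(** Polynomial after clearing denominators; it suffices to use
    [e <= 0.3536 - 0.4142 d], a rounding of the hypothesis. *)
Lemma univalence_constant_lt (e d : R) :
  (0 <= e -> 0 <= d -> (sqrt 2 - 1) * d + e < sqrt 2 / 4 ->
   2 * e / (3 - d) + 3 / (2 * (4 - d)) * (1 + (1 + e) / 2) < 1)%R.
Proof.
  intros He Hd H. pose proof (Cmod_parameter_lt e d He Hd H) as Hd1.
  destruct sqrt2_bounds as [[B1 B2] B3]. set (s := sqrt 2) in *.
  apply (Rmult_lt_reg_r (4 * ((3 - d) * (4 - d)))); [nra|].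
  replace ((2 * e / (3 - d) + 3 / (2 * (4 - d)) * (1 + (1 + e) / 2)) * (4 * ((3 - d) * (4 - d))))%R
    with (8 * e * (4 - d) + 3 * (3 + e) * (3 - d))%R by (field; lra).
  assert (He1 : (e <= 0.3536 - 0.4142 * d)%R) by nra.
  nra.
Qed.

(** [2 L + 2 + n] is [2 L - 1] translated by [n + 3]. *)
Lemma Cmod_denominator_ge (L : C) (n : nat) :
  (INR n + 3 - Cmod (2 * L - 1) <= Cmod (2 * L + 2 + INR n))%R.
Proof.
  pose proof (Cmod_triangle (2 * L + 2 + INR n) (- (2 * L - 1))) as T.
  replace (2 * L + 2 + INR n + - (2 * L - 1)) with (RtoC (INR n + 3)) in T
    by (rewrite RtoC_plus; ring).
  rewrite Cmod_opp, Cmod_R, Rabs_pos_eq in T by (pose proof (pos_INR n); lra). lra.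
Qed.

Lemma denominator_neq_0 (L : C) (n : nat) :
  (Cmod (2 * L - 1) < 3)%R -> 2 * L + 2 + INR n <> 0.
Proof.
  intros H E. pose proof (Cmod_denominator_ge L n) as G.
  rewrite E, Cmod_0 in G. pose proof (pos_INR n). lra.
Qed.

(** From index 1 on the factor in front of the Riccati coefficient is at least
    [4 - |2 L - 1|] in modulus, and the right-hand side consists of the coefficient
    [-1] of [z] and of those of [z r^2]. *)
Lemma sum_Cmod_riccati_tail_le (eta L : C) (N : nat) :
  (Cmod (2 * L - 1) < 3)%R ->
  ((4 - Cmod (2 * L - 1)) * sum_n (fun n => Cmod (riccati_coeff eta L (S n))) N
   <= 1 + sum_n (fun n => Cmod (conv (riccati_coeff eta L) (riccati_coeff eta L) n)) N)%R.
Proof.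
  intro Hd. set (r := riccati_coeff eta L).
  assert (step : forall n, ((4 - Cmod (2 * L - 1)) * Cmod (r (S n))
      <= Cmod (conv_unit n) + Cmod (conv r r n))%R).
  { intro n. pose proof (Cmod_denominator_ge L (S n)) as G.
    rewrite S_INR in G. pose proof (pos_INR n).
    apply Rle_trans with (Cmod ((2 * L + 2 + INR (S n)) * r (S n))).
    - rewrite Cmod_mult. apply Rmult_le_compat_r; [apply Cmod_ge_0|].
      rewrite S_INR. lra.
    - unfold r. rewrite riccati_eq by (apply denominator_neq_0; exact Hd). fold r.
      unfold riccati_rhs. cbn [conv_unit shift].
      replace (2 * eta * 0 + -1 * conv_unit n - conv r r n) with (- (conv_unit n + conv r r n)) by ring.
      rewrite Cmod_opp. apply Cmod_triangle. }
  induction N as [|N IH].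
  - rewrite !sum_O. pose proof (step 0%nat) as H. simpl (conv_unit 0) in H.
    rewrite Cmod_1 in H. exact H.
  - rewrite !sum_n_last. pose proof (step (S N)) as H. simpl (conv_unit (S N)) in H.
    rewrite Cmod_0 in H. lra.
Qed.

(** The partial sums [s N] satisfy
    [s (N + 1) <= 2 |eta| / (3 - d) + (1 + (s N) ^ 2) / (4 - d)]; by
    [riccati_fixpoint_lt] the bound [s N <= sqrt 2 - 1] reproduces itself, in the
    sharper form stated here. *)
Lemma sum_Cmod_riccati_le (eta L : C) (N : nat) :
  ((sqrt 2 - 1) * Cmod (2 * L - 1) + 2 * Cmod eta < sqrt 2 / 4)%R ->
  (sum_n (fun n => Cmod (riccati_coeff eta L n)) N
   <= 2 * Cmod eta / (3 - Cmod (2 * L - 1))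
      + (1 + (sqrt 2 - 1) ^ 2) / (4 - Cmod (2 * L - 1)))%R.
Proof.
  intro H. pose proof (Cmod_ge_0 eta) as He. pose proof (Cmod_ge_0 (2 * L - 1)) as Hd.
  assert (He2 : (0 <= 2 * Cmod eta)%R) by lra.
  pose proof (Cmod_parameter_lt _ _ He2 Hd H) as Hd1.
  pose proof (riccati_fixpoint_lt _ _ He2 Hd H) as F.
  destruct sqrt2_bounds as [[B1 B2] B3].
  pose proof (sum_Cmod_riccati_tail_le eta L) as T.
  pose proof (Cmod_denominator_ge L 0) as G0. simpl (INR 0) in G0.
  assert (R0 : (Cmod (riccati_coeff eta L 0) <= 2 * Cmod eta / (3 - Cmod (2 * L - 1)))%R).
  { apply Rmult_le_reg_l with (3 - Cmod (2 * L - 1))%R; [lra|].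
    replace ((3 - Cmod (2 * L - 1)) * (2 * Cmod eta / (3 - Cmod (2 * L - 1))))%R
      with (2 * Cmod eta)%R by (field; lra).
    apply Rle_trans with (Cmod ((2 * L + 2 + INR 0) * riccati_coeff eta L 0)).
    - rewrite Cmod_mult. apply Rmult_le_compat_r; [apply Cmod_ge_0|].
      simpl (INR 0). lra.
    - rewrite riccati_eq by (apply denominator_neq_0; lra).
      unfold riccati_rhs. cbn [conv_unit shift].
      replace (2 * eta * 1 + -1 * 0 - 0) with (2 * eta) by ring.
      rewrite Cmod_mult, Cmod_R, Rabs_pos_eq; lra. }
  set (d := Cmod (2 * L - 1)) in *. set (e := (2 * Cmod eta)%R) in *.
  assert (K0 : (0 <= (1 + (sqrt 2 - 1) ^ 2) / (4 - d))%R).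
  { apply Rdiv_le_0_compat; [nra|lra]. }
  induction N as [|N IH].
  - rewrite sum_O. simpl in *. lra.
  - rewrite sum_n_first.
    apply Rplus_le_compat; [exact R0|].
    apply Rmult_le_reg_l with (4 - d)%R; [lra|].
    replace ((4 - d) * ((1 + (sqrt 2 - 1) ^ 2) / (4 - d)))%R
      with (1 + (sqrt 2 - 1) ^ 2)%R by (field; lra).
    apply Rle_trans with (1 := T N ltac:(lra)).
    apply Rplus_le_compat_l.
    apply Rle_trans with (1 := sum_Cmod_conv_le _ _ N).
    pose proof (sum_n_Cmod_ge_0 (riccati_coeff eta L) N) as P.
    rewrite <- Rsqr_pow2. unfold Rsqr. apply Rmult_le_compat; lra.
Qed.

(** The worst case of [(n + 3) / ((n + 2) (n + 4 - d)) <= 3 / (2 (4 - d))] is [n = 0].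
    The coefficient of index [n + 1] is bounded by half of its weighted version, so
    that the inequality can be summed. *)
Lemma univalence_step_le (eta L : C) (n : nat) :
  (Cmod (2 * L - 1) < 3)%R ->
  (INR (S (S (S n))) * Cmod (coulomb_coeff eta L (S (S n)))
   <= 3 / (2 * (4 - Cmod (2 * L - 1)))
      * (2 * Cmod eta * (INR (S (S n)) * Cmod (coulomb_coeff eta L (S n)) / 2)
         + Cmod (coulomb_coeff eta L n)))%R.
Proof.
  intro Hd. pose proof (coulomb_coeff_S eta L (S n) (denominator_neq_0 L (S n) Hd)) as E.
  pose proof (Cmod_denominator_ge L (S n)) as G.
  apply (f_equal Cmod) in E. cbn [shift] in E.
  rewrite !Cmod_mult, Cmod_R, Rabs_pos_eq in E by apply pos_INR.
  pose proof (Cmod_triangle (2 * eta * coulomb_coeff eta L (S n)) (- coulomb_coeff eta L n)) as T.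
  rewrite Cmod_opp, !Cmod_mult, Cmod_R, (Rabs_pos_eq 2) in T by lra.
  change (Cmod (2 * eta * coulomb_coeff eta L (S n) + - coulomb_coeff eta L n))
    with (Cmod (2 * eta * coulomb_coeff eta L (S n) - coulomb_coeff eta L n)) in T.
  rewrite <- E in T.
  pose proof (Cmod_ge_0 (coulomb_coeff eta L (S (S n)))) as P2.
  pose proof (Cmod_ge_0 (coulomb_coeff eta L (S n))) as P1.
  pose proof (Cmod_ge_0 (coulomb_coeff eta L n)) as P0.
  pose proof (Cmod_ge_0 eta) as Pe. pose proof (Cmod_ge_0 (2 * L - 1)) as Pd.
  rewrite !S_INR in *. pose proof (pos_INR n) as Pn.
  set (x := INR n) in *. set (d := Cmod (2 * L - 1)) in *.
  set (a2 := Cmod (coulomb_coeff eta L (S (S n)))) in *.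
  set (a1 := Cmod (coulomb_coeff eta L (S n))) in *.
  set (a0 := Cmod (coulomb_coeff eta L n)) in *.
  set (D := Cmod (2 * L + 2 + (x + 1)%R)) in *.
  assert (H1 : ((x + 4 - d) * ((x + 2) * a2) <= 2 * Cmod eta * a1 + a0)%R).
  { apply Rle_trans with (2 := T). replace (x + 1 + 1)%R with (x + 2)%R by ring.
    apply Rmult_le_compat_r; [|lra]. apply Rmult_le_pos; lra. }
  assert (H2 : (2 * (4 - d) * ((x + 3) * a2) <= 3 * ((x + 4 - d) * ((x + 2) * a2)))%R).
  { replace (2 * (4 - d) * ((x + 3) * a2))%R with (2 * (4 - d) * (x + 3) * a2)%R by ring.
    replace (3 * ((x + 4 - d) * ((x + 2) * a2)))%R with (3 * (x + 4 - d) * (x + 2) * a2)%R by ring.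
    apply Rmult_le_compat_r; [exact P2|]. nra. }
  assert (H3 : (2 * Cmod eta * a1 <= 2 * Cmod eta * ((x + 1 + 1) * a1 / 2))%R).
  { apply Rmult_le_compat_l; [lra|]. nra. }
  apply Rmult_le_reg_l with (2 * (4 - d))%R; [lra|].
  match goal with |- (_ <= ?r)%R => replace r with
    (3 * (2 * Cmod eta * ((x + 1 + 1) * a1 / 2) + a0))%R by (field; lra) end.
  replace (x + 1 + 1 + 1)%R with (x + 3)%R by ring. lra.
Qed.

(** Summing the step inequality bounds each weighted partial sum affinely by the
    previous one; the bound 1 reproduces itself by [univalence_constant_lt]. *)
Lemma sum_univalence_le (eta L : C) (N : nat) :
  ((sqrt 2 - 1) * Cmod (2 * L - 1) + 2 * Cmod eta < sqrt 2 / 4)%R ->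
  (sum_n (fun n => INR (S (S n)) * Cmod (coulomb_coeff eta L (S n)))%R N
   <= 2 * (2 * Cmod eta) / (3 - Cmod (2 * L - 1))
      + 3 / (2 * (4 - Cmod (2 * L - 1))) * (1 + (1 + 2 * Cmod eta) / 2))%R.
Proof.
  intro H. pose proof (Cmod_ge_0 eta) as He. pose proof (Cmod_ge_0 (2 * L - 1)) as Hd.
  assert (He2 : (0 <= 2 * Cmod eta)%R) by lra.
  pose proof (Cmod_parameter_lt _ _ He2 Hd H) as Hd1.
  pose proof (univalence_constant_lt _ _ He2 Hd H) as F.
  set (a := coulomb_coeff eta L).
  set (t := fun n => (INR (S (S n)) * Cmod (a (S n)))%R).
  pose proof (fun n => univalence_step_le eta L n ltac:(lra)) as step. fold a in step.
  assert (Hat : forall n, (Cmod (a (S n)) <= t n / 2)%R).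
  { intro n. unfold t. rewrite !S_INR. pose proof (pos_INR n).
    pose proof (Cmod_ge_0 (a (S n))). nra. }
  (* the first coefficient is [2 eta / (2 L + 2)] *)
  assert (T0 : (t 0%nat <= 2 * (2 * Cmod eta) / (3 - Cmod (2 * L - 1)))%R).
  { pose proof (coulomb_coeff_S eta L 0 (denominator_neq_0 L 0 ltac:(lra))) as E.
    apply (f_equal Cmod) in E. cbn [shift] in E.
    replace (2 * eta * coulomb_coeff eta L 0 - 0) with (2 * eta) in E by (simpl; ring).
    rewrite !Cmod_mult, !Cmod_R, (Rabs_pos_eq 2), Rabs_pos_eq in E by (lra || apply pos_INR).
    fold a in E. unfold t. pose proof (Cmod_denominator_ge L 0) as G.
    pose proof (Cmod_ge_0 (a 1%nat)) as P. simpl (INR 1) in *. simpl (INR 2) in *.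
    simpl (INR 0) in *.
    apply Rmult_le_reg_l with (3 - Cmod (2 * L - 1))%R; [lra|].
    match goal with |- (_ <= ?r)%R => replace r with (2 * (2 * Cmod eta))%R by (field; lra) end.
    rewrite <- E. 
    assert ((3 - Cmod (2 * L - 1)) * Cmod (a 1%nat) <= Cmod (2 * L + 2 + 0%R) * Cmod (a 1%nat))%R
      by (apply Rmult_le_compat_r; lra).
    lra. }
  set (d := Cmod (2 * L - 1)) in *. set (e := (2 * Cmod eta)%R) in *.
  set (K := (3 / (2 * (4 - d)))%R) in *.
  assert (HK : (0 <= K)%R) by (apply Rdiv_le_0_compat; lra).
  assert (S1 : forall n, (sum_n t (S n) <= t 0%nat
     + K * (e / 2 * sum_n t n + sum_n (fun k => Cmod (a k)) n))%R).
  { induction n as [|n IH].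
    - rewrite sum_n_last, !sum_O. specialize (step 0%nat). fold (t 1%nat) (t 0%nat) in step.
      lra.
    - rewrite (sum_n_last t (S n)), (sum_n_last t n) at 1.
      rewrite (sum_n_last (fun k => Cmod (a k))), <- (sum_n_last t n).
      specialize (step (S n)). fold (t (S n)) (t (S (S n))) in step.
      rewrite (sum_n_last t n) in *. lra. }
  assert (S2 : forall n, (sum_n (fun k => Cmod (a k)) n <= 1 + sum_n t n / 2)%R).
  { assert (S3 : forall n, (sum_n (fun k => Cmod (a (S k))) n <= sum_n t n / 2)%R).
    { induction n as [|n IH].
      - rewrite !sum_O. apply Hat.
      - rewrite !sum_n_last. pose proof (Hat (S n)). lra. }
    intro n. pose proof (sum_n_last (fun k => Cmod (a k)) n) as E.
    rewrite sum_n_first in E. unfold a in E at 1. simpl (coulomb_coeff eta L 0) in E.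
    rewrite Cmod_1 in E. pose proof (Cmod_ge_0 (a (S n))). specialize (S3 n). lra. }
  change (sum_n t N <= 2 * e / (3 - d) + K * (1 + (1 + e) / 2))%R.
  induction N as [|N IH].
  - rewrite sum_O. assert (0 <= K * (1 + (1 + e) / 2))%R by (apply Rmult_le_pos; lra). lra.
  - apply Rle_trans with (1 := S1 N). apply Rplus_le_compat; [exact T0|].
    apply Rmult_le_compat_l; [exact HK|]. specialize (S2 N).
    assert (sum_n t N <= 1)%R by lra.
    assert (e / 2 * sum_n t N <= e / 2 * 1)%R by (apply Rmult_le_compat_l; lra).
    lra.
Qed.

(** * The Coulomb function on the disk *)

(** For two points of the disk, the terms of degree at least 2 contribute at most
    [c |z - w|] to the difference of the values, which is less than the
    contribution [z - w] of the linear term. *)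
Lemma power_series_shift_injective (a : nat -> C) (c : R) :
  a 0%nat = 1 -> (c < 1)%R ->
  (forall N, sum_n (fun n => INR (S (S n)) * Cmod (a (S n)))%R N <= c)%R ->
  univalent_on_disk (power_series (shift a)).
Proof.
  intros Ha0 Hc Hb z w Hz Hw E. unfold unit_disk in *.
  set (b := fun n => INR (S (S n)) * a (S n)).
  assert (Bb : forall n, Cmod (b n) = (INR (S (S n)) * Cmod (a (S n)))%R).
  { intro n. unfold b. rewrite Cmod_mult, Cmod_R, Rabs_pos_eq by apply pos_INR. reflexivity. }
  assert (Hb' : forall N, (sum_n (fun n => Cmod (b n)) N <= c)%R).
  { intro N. rewrite (sum_n_ext _ (fun n => INR (S (S n)) * Cmod (a (S n)))%R) by exact Bb.
    apply Hb. }
  pose proof (summable_of_bounded b c Hb') as Sb.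
  assert (Sa : summable a).
  { apply (ex_series_incr_1 (fun n => Cmod (a n))).
    apply (summable_le (fun n => a (S n)) (fun n => Cmod (b n))); [|exact Sb].
    intro n. rewrite Bb, !S_INR. pose proof (pos_INR n).
    pose proof (Cmod_ge_0 (a (S n))). nra. }
  pose proof (summable_shift a Sa) as Ss.
  set (t := fun n => shift a n * z ^ n + (-1) * (shift a n * w ^ n)).
  assert (St : summable t).
  { apply summable_plus; [|apply summable_scal]; apply summable_pow; auto; lra. }
  assert (Et : CSeries t = 0).
  { unfold t. rewrite CSeries_plus, CSeries_scal.
    - change (power_series (shift a) z + (-1) * power_series (shift a) w = 0). rewrite E. ring.
    - apply summable_pow; auto; lra.
    - apply summable_pow; auto; lra.
    - apply summable_scal, summable_pow; auto; lra. }
  assert (S1 : summable (fun n => t (S n))) by (apply (ex_series_incr_1 (fun n => Cmod (t n))); exact St).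
  assert (S2 : summable (fun n => t (S (S n)))) by (apply (ex_series_incr_1 (fun n => Cmod (t (S n)))); exact S1).
  rewrite CSeries_incr_1, CSeries_incr_1 in Et by assumption.
  replace (t 0%nat) with (RtoC 0) in Et by (unfold t; simpl; ring).
  replace (t 1%nat) with (z - w) in Et by (unfold t; simpl; rewrite Ha0; ring).
  assert (Ez : z - w = - CSeries (fun n => t (S (S n)))).
  { transitivity (0 + (z - w + CSeries (fun n => t (S (S n)))) - CSeries (fun n => t (S (S n)))); [ring|].
    rewrite Et. ring. }
  assert (B : (Cmod (z - w) <= c * Cmod (z - w))%R).
  { rewrite Ez at 1. rewrite Cmod_opp.
    apply Rle_trans with (1 := Cmod_CSeries_le _ S2).
    apply Rle_trans with (Series (fun n => Cmod (b n) * Cmod (z - w))%R).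
    - apply Series_le; [|exact (ex_series_scal_r _ _ Sb)].
      intro n. split; [apply Cmod_ge_0|].
      replace (t (S (S n))) with (a (S n) * (z ^ S (S n) - w ^ S (S n)))
        by (unfold t; cbn [shift]; ring).
      rewrite Bb, Cmod_mult.
      pose proof (pow_diff_le w z (S (S n)) ltac:(lra) ltac:(lra)) as P.
      pose proof (Cmod_ge_0 (a (S n))) as Q.
      apply Rle_trans with (1 := Rmult_le_compat_l _ _ _ Q P). right; ring.
    - rewrite Series_scal_r. apply Rmult_le_compat_r; [apply Cmod_ge_0|].
      apply Series_le_of_bounded. exact Hb'. }
  destruct (Ceq_dec z w) as [e|ne]; [exact e|].
  apply Cminus_eq_contra, Cmod_gt_0 in ne. nra.
Qed.

Lemma Csqrt_sqr (p : C) : (0 < Re p)%R -> Csqrt (p * p) = p.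
Proof.
  destruct p as [x y]. intro Hx. simpl in Hx. unfold Csqrt.
  rewrite Cmod_mult. pose proof (Cmod2_alt (x, y)) as M. simpl in M.
  replace (Cmod (x, y) * Cmod (x, y))%R with (x * x + y * y)%R by (simpl in M; lra).
  simpl (Re _). simpl (Im _).
  replace ((x * x + y * y + (x * x - y * y)) / 2)%R with (x * x)%R by field.
  replace ((x * x + y * y - (x * x - y * y)) / 2)%R with (Rsqr y) by (unfold Rsqr; field).
  rewrite sqrt_square by lra. rewrite sqrt_Rsqr_abs. f_equal.
  destruct (Rlt_dec (x * y + y * x) 0) as [H|H].
  - rewrite Rabs_left; nra.
  - rewrite Rabs_right; nra.
Qed.

Lemma coulomb_g_power_series (eta L z : C) :
  (forall n, 2 * L + 2 + INR n <> 0) -> summable (coulomb_coeff eta L) ->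
  (Cmod z < 1)%R ->
  coulomb_g L eta z = power_series (shift (coulomb_coeff eta L)) z.
Proof.
  intros HD Ha Hz. rewrite power_series_shift by (lra || exact Ha).
  unfold coulomb_g, kummer.
  rewrite (CSeries_ext _ (fun n => conv exp_i_coeff (coulomb_coeff eta L) n * z ^ n)).
  2:{ intro n. rewrite <- kummer_coeff by exact HD. rewrite !Cpow_mult_l. ring. }
  change (CSeries (fun n => conv exp_i_coeff (coulomb_coeff eta L) n * z ^ n))
    with (power_series (conv exp_i_coeff (coulomb_coeff eta L)) z).
  rewrite power_series_conv; [|lra|apply summable_exp|exact Ha].
  replace (power_series exp_i_coeff z) with (Cexp (Ci * z)).
  - transitivity (z * (Cexp (- (Ci * z)) * Cexp (Ci * z)) * power_series (coulomb_coeff eta L) z); [ring|].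
    rewrite Cexp_opp_l. ring.
  - rewrite Cexp_series. apply CSeries_ext. intro n. unfold exp_i_coeff.
    rewrite Cpow_mult_l. field. apply INR_fact_C_neq_0.
Qed.

Lemma unit_disk_locally (z : C) :
  (Cmod z < 1)%R -> locally (T := AbsRing_UniformSpace C_AbsRing) z (fun w : C => Cmod w < 1)%R.
Proof.
  intro Hz. assert (P : (0 < 1 - Cmod z)%R) by lra.
  exists (mkposreal _ P). intros w Hw. change (Cmod (w - z) < 1 - Cmod z)%R in Hw.
  replace w with (z + (w - z)) by ring.
  apply Rle_lt_trans with (1 := Cmod_triangle _ _). lra.
Qed.

Theorem theorem2 :
  forall eta L : C,
    ((sqrt 2 - 1) * Cmod (2 * L - 1)%C + 2 * Cmod eta < sqrt 2 / 4)%R ->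
    lemniscate_starlike (coulomb_g L eta).
Proof.
  intros eta L H.
  pose proof (Cmod_ge_0 eta) as He. pose proof (Cmod_ge_0 (2 * L - 1)) as Hd.
  assert (He2 : (0 <= 2 * Cmod eta)%R) by lra.
  pose proof (Cmod_parameter_lt _ _ He2 Hd H) as Hd1.
  pose proof (riccati_fixpoint_lt _ _ He2 Hd H) as Fr.
  pose proof (univalence_constant_lt _ _ He2 Hd H) as Fa.
  pose proof (fun N => sum_Cmod_riccati_le eta L N H) as Br.
  pose proof (fun N => sum_univalence_le eta L N H) as Ba.
  assert (HD : forall n, 2 * L + 2 + INR n <> 0)
    by (intro n; apply denominator_neq_0; lra).
  destruct sqrt2_bounds as [[B1 B2] B3].
  set (a := coulomb_coeff eta L) in *. set (r := riccati_coeff eta L) in *.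
  assert (Sr : summable r) by (eapply summable_of_bounded; exact Br).
  assert (Sd : summable (derive_coeff (shift a))).
  { apply (ex_series_incr_1 (fun n => Cmod (derive_coeff (shift a) n))).
    eapply (summable_of_bounded (fun n => derive_coeff (shift a) (S n))). intro N.
    eapply Rle_trans; [|apply (Ba N)]. apply sum_n_m_le. intro n.
    unfold derive_coeff. cbn [shift]. rewrite Cmod_mult, Cmod_R, Rabs_pos_eq by apply pos_INR.
    apply Rle_refl. }
  assert (Sa : summable a).
  { apply (summable_le _ _) with (2 := Sd). intro n. unfold derive_coeff. cbn [shift].
    rewrite Cmod_mult, Cmod_R, Rabs_pos_eq, S_INR by apply pos_INR.
    pose proof (pos_INR n). pose proof (Cmod_ge_0 (a n)). nra. }
  assert (Gp : forall z, (Cmod z < 1)%R -> coulomb_g L eta z = power_series (shift a) z)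
    by (intros z Hz; apply coulomb_g_power_series; assumption).
  assert (Gd : forall z, (Cmod z < 1)%R ->
    is_derive (K := C_AbsRing) (V := C_NormedModule) (coulomb_g L eta) z (power_series (derive_coeff (shift a)) z)).
  { intros z Hz. apply (is_derive_ext_loc (power_series (shift a))).
    - apply filter_imp with (2 := unit_disk_locally z Hz).
      intros w Hw. symmetry. apply Gp, Hw.
    - apply is_derive_power_series; [apply summable_shift, Sa|exact Hz]. }
  assert (U : univalent_on_disk (coulomb_g L eta)).
  { intros z w Hz Hw. rewrite (Gp z Hz), (Gp w Hw).
    apply (power_series_shift_injective a _ eq_refl Fa Ba); assumption. }
  assert (C0 : (Cmod 0 < 1)%R) by (rewrite Cmod_0; lra).
  assert (g0 : coulomb_g L eta 0 = 0) by (unfold coulomb_g; ring).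
  (* [q = z g' / g - 1] *)
  set (q := shift r). pose proof (summable_shift r Sr) as Sq. fold q in Sq.
  assert (Hq : forall z, (Cmod z < 1)%R -> (Cmod (power_series q z) < sqrt 2 - 1)%R).
  { intros z Hz. unfold q. rewrite power_series_shift by (lra || exact Sr). rewrite Cmod_mult.
    pose proof (Cmod_power_series_le r z ltac:(lra) Sr) as P.
    pose proof (Series_le_of_bounded r _ Br) as P2.
    pose proof (Cmod_ge_0 z). pose proof (Cmod_ge_0 (power_series r z)). nra. }
  assert (Gq : forall z, (Cmod z < 1)%R ->
     z * C_derive (coulomb_g L eta) z = coulomb_g L eta z * (1 + power_series q z)).
  { intros z Hz. rewrite (is_C_derive_unique _ _ _ (Gd z Hz)), (Gp z Hz).
    unfold q. rewrite !power_series_shift by (lra || assumption).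
    transitivity (z * power_series (fun n => a n + shift (conv r a) n) z).
    - f_equal. apply CSeries_ext. intro n. f_equal. unfold derive_coeff. cbn [shift].
      unfold a at 2, r. rewrite <- theta_coulomb_coeff by exact HD.
      unfold theta. fold a. rewrite RtoC_INR_S. ring.
    - rewrite power_series_plus, power_series_shift, power_series_conv;
        try apply summable_shift; try apply summable_conv; try assumption; try lra.
      ring. }
  split; [split; [split; [|split]|]|].
  - intros z Hz. eexists. apply Gd, Hz.
  - exact g0.
  - rewrite (is_C_derive_unique _ _ _ (Gd 0 C0)).
    rewrite power_series_0 by exact Sd. unfold derive_coeff. apply Cmult_1_r.
  - exact U.
  (* The Schwarz function [w = (1 + q)^2 - 1 = 2 q + q^2], given as a power series
     so that its analyticity is that of power series. *)
  - exists (power_series (fun n => 2 * q n + conv q q n)).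
    assert (Sw : summable (fun n => 2 * q n + conv q q n))
      by (apply summable_plus; [apply summable_scal|apply summable_conv]; assumption).
    assert (Ew : forall z, (Cmod z < 1)%R ->
      power_series (fun n => 2 * q n + conv q q n) z = power_series q z * (2 + power_series q z)).
    { intros z Hz. rewrite power_series_plus, power_series_scal, power_series_conv;
        try apply summable_scal; try apply summable_conv; try assumption; try lra.
      ring. }
    assert (q0 : power_series q 0 = 0) by (rewrite power_series_0 by exact Sq; reflexivity).
    repeat split.
    + intros z Hz. eexists. apply is_derive_power_series; [exact Sw|exact Hz].
    + rewrite (Ew 0 C0), q0. ring.
    + intros z Hz. rewrite (Ew z Hz), Cmod_mult. specialize (Hq z Hz).
      pose proof (Cmod_triangle 2 (power_series q z)) as T. rewrite Cmod_R, Rabs_pos_eq in T by lra.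
      pose proof (Cmod_ge_0 (power_series q z)).
      (* [|q| (2 + |q|) < (sqrt 2 - 1) (sqrt 2 + 1) = 1] *)
      nra.
    + intros z Hz. rewrite (Ew z Hz).
      replace (1 + power_series q z * (2 + power_series q z)) with ((1 + power_series q z) * (1 + power_series q z)) by ring.
      rewrite Csqrt_sqr.
      2:{ rewrite re_plus, re_RtoC. specialize (Hq z Hz).
          pose proof (re_le_Cmod (power_series q z)) as T. apply Rabs_le_between in T. lra. }
      unfold log_derivative_ratio. destruct (Ceq_dec z 0) as [->|Hz0].
      * rewrite q0. ring.
      * rewrite (Gq z Hz).
        (* univalence makes 0 the only zero *)
        assert (coulomb_g L eta z <> 0).
        { intro E. apply Hz0. apply U; [exact Hz|exact C0|]. rewrite E, g0. reflexivity. }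
        field. assumption.
Qed.
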